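(* Let $n \geq 3$, and for $i\in\{1,2,3\}$ let $A_i$ be a real symmetric $n\times n$ matrix, $b_i\in\mathbb{R}^n$ and $c_i\in\mathbb{R}$. Let \[ S = \left\{ x \in \mathbb{R}^n : \begin{bmatrix} x \\ 1 \end{bmatrix}^{\top} \begin{bmatrix} A_i & b_i \\ b_i^{\top} & c_i \end{bmatrix} \begin{bmatrix} x \\ 1 \end{bmatrix} < 0,\ i \in \{1,2,3\} \right\}. \] Assume: (1) there exists $\theta\in\mathbb{R}^3$ such that $\sum_{i=1}^3 \theta_i \begin{bmatrix} A_i & b_i \\ b_i^{\top} & c_i \end{bmatrix} \succ 0$; (2) $\mathrm{conv}(S)\neq\mathbb{R}^n$. For $\lambda\in\mathbb{R}^3_+$ let \[ S_\lambda = \left\{ x\in\mathbb{R}^n : \begin{bmatrix} x \\ 1 \end{bmatrix}^{\top} \left(\sum_{i=1}^3 \lambda_i \begin{bmatrix} A_i & b_i \\ b_i^{\top} & c_i \end{bmatrix}\right) \begin{bmatrix} x \\ 1 \end{bmatrix} < 0 \right\}, \] let $\nu(S_\lambda)$ be the number of negative eigenvalues of $\sum_{i=1}^3\lambda_i A_i$, and let \[ \Omega = \{\lambda\in\mathbb{R}^3_+ : S_\lambda \supseteq \mathrm{conv}(S) \text{ and } \nu(S_\lambda)\leq 1\}. \] Then \[ \mathrm{conv}(S) = \bigcap_{\lambda\in\Omega} S_\lambda. \]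
   Context: $\mathbb{R}^3_+$ is the set of vectors in $\mathbb{R}^3$ with all entries nonnegative. For a symmetric matrix $M$, $M\succ 0$ means $M$ is positive definite. $\mathrm{conv}$ denotes the convex hull. Eigenvalues are counted with multiplicity. *)

(* Defs.v *)
From HB Require Import structures.
From mathcomp Require Import all_boot all_order all_algebra.
From mathcomp Require Import all_classical all_reals convex.

Set Implicit Arguments.
Unset Strict Implicit.
Unset Printing Implicit Defensive.

Import Order.TTheory GRing.Theory Num.Theory.
Local Open Scope classical_set_scope.
Local Open Scope ring_scope.

Definition conv_hull (R : realType) (n : nat) (X : set 'cV[R]_n) :
    set 'cV[R]_n :=
  smallest (@convex_set R 'cV[R]_n) X.

Definition qform (R : realType) (m : nat) (Q : 'M[R]_m) (v : 'cV[R]_m) : R :=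
  (v^T *m Q *m v) 0 0.

Definition posdefmx (R : realType) (m : nat) (Q : 'M[R]_m) : Prop :=
  Q \is symmetricmx /\ forall v : 'cV[R]_m, v != 0 -> 0 < qform Q v.

(* The sum has finite support: [mup a p] vanishes unless [a] is a root of [p],
   and [char_poly M] is nonzero. *)
Definition num_neg_eigenvalues (R : realType) (m : nat) (M : 'M[R]_m) : nat :=
  \big[addn/0%N]_(a \in [set a : R | a < 0]) mup a (char_poly M).

Definition quad_mx (R : realType) (n : nat) (A : 'M[R]_n) (b : 'cV[R]_n)
    (c : R) : 'M[R]_(n + 1) :=
  block_mx A b b^T c%:M.

Definition neg_set (R : realType) (n : nat) (Q : 'M[R]_(n + 1)) :
    set 'cV[R]_n :=
  [set x | qform Q (col_mx x 1%:M) < 0].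

Section Aggregation.
Variables (R : realType) (n : nat).
Variables (A : 'I_3 -> 'M[R]_n) (b : 'I_3 -> 'cV[R]_n) (c : 'I_3 -> R).

Definition sol_set : set 'cV[R]_n :=
  [set x | forall i, neg_set (quad_mx (A i) (b i) (c i)) x].

Definition agg_mx (lambda : 'cV[R]_3) : 'M[R]_(n + 1) :=
  \sum_i lambda i 0 *: quad_mx (A i) (b i) (c i).

Definition agg_set (lambda : 'cV[R]_3) : set 'cV[R]_n :=
  neg_set (agg_mx lambda).

Definition good_multipliers : set 'cV[R]_3 :=
  [set lambda : 'cV[R]_3 | [/\ forall i, 0 <= lambda i 0,
                    conv_hull sol_set `<=` agg_set lambda
                  & (num_neg_eigenvalues
                       (\sum_i lambda i 0 *: A i) <= 1)%N]].

End Aggregation.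

(* Main.v *)
Require Import Defs.
From mathcomp Require Import all_boot all_order all_algebra.
From mathcomp Require Import all_classical all_reals interval_inference convex.
From mathcomp Require Import ring lra.

(** Why the two sets agree.

    One inclusion is part of the definition of a good multiplier. For the other
    one, let [y] be a point outside [conv S]. The set [conv S] is convex and
    open, so some affine function vanishes at [y] and is positive on [conv S]
    ([separation]). Let [H] be the linear hyperplane of R^(n+1) that this
    function cuts out after homogenization (the whole space if the function is
    zero, which can only happen when [S] is empty); it contains [(y, 1)]. No
    vector of [H] makes the three homogenized forms negative at once: a vector
    [(x, s)] with [s != 0] would put [x / s] in [S], and a vector [(x, 0)] can
    be pushed off the hyperplane at infinity in the direction [(y, 1)].

    The core of the argument is a theorem of alternatives for three quadratic
    forms on a space of dimension at least 3 some combination of which is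
    positive definite ([nonneg_multipliers]). Their joint image in R^3 is a
    convex cone ([joint_value_add]), so it can be separated from the negative
    orthant, and the separating functional is a nonzero [lambda >= 0] whose
    aggregated form [q] is nonnegative on [H]. Convexity of the joint image is a
    connectedness statement: given two vectors with independent values [p] and
    [p'], the combination [B] of the forms that vanishes at [p] and [p'] has them
    in its isotropic cone, and in dimension at least 3 any two isotropic
    vectors are joined, up to sign, by isotropic arcs avoiding 0. Along such
    an arc the joint value stays in the plane of [p] and [p'], so it crosses the
    ray of [p + p'] ([isotropic_ivt]). The arcs are conics with polynomial
    parametrizations, so the intermediate value property of polynomials is
    enough.

    That [q] is nonnegative on [H] gives everything else. It makes [q]
    nonnegative at [(y, 1)], so [y] is not in [S_lambda]. On one side of [H] it
    makes the cone [q < 0] convex, by a reversed Cauchy-Schwarz inequality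
    ([bform_lt0]); as [S] lies on one side of [H], [S_lambda] contains [conv S].
    Finally, restricted to the vectors [(x, 0)], it says that the quadratic part
    of [q] is nonnegative on the orthogonal of a vector, which leaves room for
    at most one negative eigenvalue ([num_neg_eigenvalues_le1]). *)

Import Order.TTheory GRing.Theory Num.Theory.
Local Open Scope classical_set_scope.
Local Open Scope ring_scope.

Set Implicit Arguments.
Unset Strict Implicit.
Unset Printing Implicit Defensive.

(** * Bilinear forms and the dot product *)

Definition bform (R : realType) (m : nat) (Q : 'M[R]_m) (u v : 'cV[R]_m) : R :=
  (u^T *m Q *m v) 0 0.

Definition dot (R : realType) (m : nat) (u v : 'cV[R]_m) : R := (u^T *m v) 0 0.

Section Forms.
Variables (R : realType) (m : nat).
Implicit Types (Q : 'M[R]_m) (u v w : 'cV[R]_m).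

Lemma qformE Q u : qform Q u = bform Q u u. Proof. by []. Qed.

Lemma bformDl Q u v w : bform Q (u + v) w = bform Q u w + bform Q v w.
Proof. by rewrite /bform linearD /= !mulmxDl mxE. Qed.

Lemma bformDr Q u v w : bform Q u (v + w) = bform Q u v + bform Q u w.
Proof. by rewrite /bform mulmxDr mxE. Qed.

Lemma bformZl Q a u v : bform Q (a *: u) v = a * bform Q u v.
Proof. by rewrite /bform linearZ /= -!scalemxAl mxE. Qed.

Lemma bformZr Q a u v : bform Q u (a *: v) = a * bform Q u v.
Proof. by rewrite /bform -scalemxAr mxE. Qed.

Lemma bformC Q u v : Q^T = Q -> bform Q u v = bform Q v u.
Proof.
move=> symQ; rewrite /bform.
have -> : v^T *m Q *m u = (u^T *m Q *m v)^T.
  by rewrite !trmx_mul symQ trmxK mulmxA.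
by rewrite [RHS]mxE.
Qed.

Lemma bform_dot Q u v : bform Q u v = dot (Q^T *m u) v.
Proof. by rewrite /bform /dot trmx_mul trmxK. Qed.

Lemma bform_sum (I : finType) (a : I -> R) (P : I -> 'M[R]_m) u v :
  bform (\sum_i a i *: P i) u v = \sum_i a i * bform (P i) u v.
Proof.
rewrite /bform mulmx_sumr mulmx_suml summxE; apply: eq_bigr => i _.
by rewrite -scalemxAr -scalemxAl mxE.
Qed.

Lemma dotDr u v w : dot u (v + w) = dot u v + dot u w.
Proof. by rewrite /dot mulmxDr mxE. Qed.

Lemma dotZr a u v : dot u (a *: v) = a * dot u v.
Proof. by rewrite /dot -scalemxAr mxE. Qed.

Lemma dot0r u : dot u 0 = 0.
Proof. by rewrite /dot mulmx0 mxE. Qed.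

Lemma dotNl u v : dot (- u) v = - dot u v.
Proof. by rewrite /dot linearN /= mulNmx mxE. Qed.

Lemma dotE u v : dot u v = \sum_i u i 0 * v i 0.
Proof. by rewrite /dot mxE; apply: eq_bigr => i _; rewrite mxE. Qed.

Lemma dotC u v : dot u v = dot v u.
Proof. by rewrite !dotE; apply: eq_bigr => i _; rewrite mulrC. Qed.

Lemma dot_gt0 u : u != 0 -> 0 < dot u u.
Proof.
move=> /cV0Pn[i ui]; rewrite dotE (bigD1 i) //=; apply: ltr_pwDl.
  by rewrite -expr2 exprn_even_gt0 //= orbC ui.
by apply: sumr_ge0 => j _; rewrite -expr2 sqr_ge0.
Qed.

Lemma qform_lin2 Q u v (a b : R) : Q^T = Q ->
  qform Q (a *: u + b *: v) =
  a ^+ 2 * qform Q u + b ^+ 2 * qform Q v + 2 * a * b * bform Q u v.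
Proof.
move=> symQ; rewrite !qformE !(bformDl, bformDr, bformZl, bformZr).
by rewrite (bformC v u symQ); ring.
Qed.

Lemma qform_lin3 Q u v w (a b c : R) : Q^T = Q ->
  qform Q (a *: u + b *: v + c *: w) =
  a ^+ 2 * qform Q u + b ^+ 2 * qform Q v + c ^+ 2 * qform Q w +
  2 * (a * b * bform Q u v + a * c * bform Q u w + b * c * bform Q v w).
Proof.
move=> symQ; rewrite !qformE !(bformDl, bformDr, bformZl, bformZr).
by rewrite (bformC v u symQ) (bformC w u symQ) (bformC w v symQ); ring.
Qed.

Lemma qformZ Q a u : qform Q (a *: u) = a ^+ 2 * qform Q u.
Proof. by rewrite !qformE bformZl bformZr; ring. Qed.

Lemma common_orthogonal (a b c : 'cV[R]_m) : (4 <= m)%N ->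
  exists w, [/\ w != 0, dot a w = 0, dot b w = 0 & dot c w = 0].
Proof.
move=> m4; pose M : 'M[R]_(m, 1 + (1 + 1)) := row_mx a (row_mx b c).
have : kermx M != 0.
  rewrite -mxrank_eq0 mxrank_ker -lt0n subn_gt0.
  exact: leq_ltn_trans (rank_leq_col M) m4.
case/rowV0Pn => v /sub_kermxP vM v0.
have [va vb vc] : [/\ v *m a = 0, v *m b = 0 & v *m c = 0].
  move: vM; rewrite /M !mul_mx_row.
  rewrite -[RHS]row_mx0 => /eq_row_mx[-> ].
  by rewrite -[RHS]row_mx0 => /eq_row_mx[-> ->].
exists v^T; split; first by rewrite trmx_eq0.
all: by rewrite dotC /dot trmxK ?va ?vb ?vc mxE.
Qed.

(** Reversed Cauchy-Schwarz inequality. The combination of [u] and [v] that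
    lies on the hyperplane has a nonnegative value of [Q], and the cross term
    is the only one that can make it so. *)
Lemma bform_lt0 (Q : 'M[R]_m) (l u v : 'cV[R]_m) : Q^T = Q ->
  (forall w, dot l w = 0 -> 0 <= qform Q w) ->
  0 < dot l u -> 0 < dot l v -> qform Q u < 0 -> qform Q v < 0 ->
  bform Q u v < 0.
Proof.
move=> symQ psd lu lv Qu Qv.
have := psd ((dot l v) *: u + (- dot l u) *: v).
rewrite dotDr !dotZr mulNr mulrC subrr => /(_ erefl); rewrite qform_lin2 //.
move=> h; rewrite -(pmulr_rlt0 _ (mulr_gt0 lv lu)).
have : 0 < dot l v ^+ 2 by rewrite exprn_gt0.
have : 0 < dot l u ^+ 2 by rewrite exprn_gt0.
nra.
Qed.

End Forms.

(** * Zeros of a quadratic form on an isotropic cone *)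

Section IsotropicCone.
Variables (R : realType) (m : nat).
Implicit Types (F B : 'M[R]_m) (l u v w : 'cV[R]_m).

(** An arc from [u] (at [t = 0]) to [v] (at [t = 1]). When [u] and [v] are
    isotropic for a form [Q] and [w] is orthogonal to both, the value of [Q]
    along it is [t ^+ 2 * (1 - t) ^+ 2 * (2 * bform Q u v + qform Q w)], so a
    suitable [w] keeps the whole arc isotropic. *)
Definition conic u v w (t : R) :=
  ((1 - t) ^+ 2) *: u + (t ^+ 2) *: v + (t * (1 - t)) *: w.

Lemma conic_ivt F u v w : F^T = F -> qform F u < 0 -> 0 < qform F v ->
  exists t, qform F (conic u v w t) = 0.
Proof.
move=> symF Fu Fv.
pose p : {poly R} :=
  (qform F u) *: (1 - 'X) ^+ 4 + (qform F v) *: 'X ^+ 4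
  + (qform F w + 2 * bform F u v) *: ('X ^+ 2 * (1 - 'X) ^+ 2)
  + (2 * bform F u w) *: ('X * (1 - 'X) ^+ 3)
  + (2 * bform F v w) *: ('X ^+ 3 * (1 - 'X)).
have pE t : p.[t] = qform F (conic u v w t).
  rewrite qform_lin3 // /p.
  rewrite !(hornerD, hornerZ, hornerM, horner_exp, hornerN, hornerX, hornerC).
  by ring.
have [|t _ /rootP pt] := @poly_ivt R p 0 1 ler01.
  rewrite !pE /conic subr0 subrr !expr1n !expr0n !(mul0r, mulr0) /=.
  by rewrite !scale0r !scale1r !(addr0, add0r) !ltW.
by exists t; rewrite -pE.
Qed.

(** Two orthogonal isotropic vectors span a totally isotropic plane, in which
    the arc with [w = 0] stays. *)
Lemma isotropic_ivt_orthogonal F B u v :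
  F^T = F -> B^T = B -> qform F u < 0 -> 0 < qform F v ->
  qform B u = 0 -> qform B v = 0 -> bform B u v = 0 ->
  exists a b, [/\ a *: u + b *: v != 0, qform F (a *: u + b *: v) = 0
              & qform B (a *: u + b *: v) = 0].
Proof.
move=> symF symB Fu Fv Bu Bv Buv.
have [t] := @conic_ivt F u v 0 symF Fu Fv.
rewrite /conic scaler0 addr0 => Ft.
exists ((1 - t) ^+ 2), (t ^+ 2); split => //; last first.
  by rewrite qform_lin2 // Bu Bv Buv; ring.
apply/eqP => /eqP; rewrite addr_eq0 -scaleNr => /eqP eq_uv.
have : qform F ((1 - t) ^+ 2 *: u) = qform F (- t ^+ 2 *: v) by rewrite eq_uv.
rewrite !qformZ => eqF.
have [t0|t0] := eqVneq t 0; first by move: eqF; rewrite t0; lra.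
have : 0 < (- t ^+ 2) ^+ 2 * qform F v.
  by rewrite mulr_gt0 // sqrrN exprn_even_gt0 //= expf_neq0.
by rewrite -eqF nmulr_lgt0 // ltNge !sqr_ge0.
Qed.

(** On the isotropic cone of [B] in the hyperplane orthogonal to [l], a form
    taking both signs has a nonzero zero. The bound on [m] provides a nonzero
    [w] in the hyperplane that is [B]-orthogonal to [u] and [v]. If [w] is
    isotropic, the path from [u] to [v] goes through [w] inside two totally
    isotropic planes; otherwise a multiple of [w] bends the segment from [u]
    to [v], or to [-v], into an isotropic conic. In dimension 2 this fails: an
    isotropic cone can consist of two separate lines. *)
Lemma isotropic_ivt l F B u v : (4 <= m)%N ->
  F^T = F -> B^T = B -> dot l u = 0 -> dot l v = 0 ->
  qform F u < 0 -> 0 < qform F v -> qform B u = 0 -> qform B v = 0 ->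
  exists x, [/\ dot l x = 0, x != 0, qform F x = 0 & qform B x = 0].
Proof.
move=> m4 symF symB lu lv Fu Fv Bu Bv.
have orth x y : dot l x = 0 -> dot l y = 0 -> qform F x < 0 -> 0 < qform F y ->
    qform B x = 0 -> qform B y = 0 -> bform B x y = 0 ->
    exists z, [/\ dot l z = 0, z != 0, qform F z = 0 & qform B z = 0].
  move=> lx ly Fx Fy Bx By Bxy.
  have [a [b [z0 Fz Bz]]] :=
    isotropic_ivt_orthogonal symF symB Fx Fy Bx By Bxy.
  exists (a *: x + b *: y); split => //.
  by rewrite dotDr !dotZr lx ly !mulr0 addr0.
have [Buv|Buv] := eqVneq (bform B u v) 0; first exact: orth Buv.
have [w [w0 lw uw vw]] := common_orthogonal l (B^T *m u) (B^T *m v) m4.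
rewrite -bform_dot in uw; rewrite -bform_dot in vw.
have [Bw|Bw] := eqVneq (qform B w) 0.
  have [Fw|Fw|Fw] := ltgtP (qform F w) 0.
  - by apply: (orth w v) => //; rewrite bformC.
  - exact: (orth u w).
  - by exists w.
(* The arc to [s *: v] bent by [r *: w] is isotropic when
   [2 * s * bform B u v + r ^+ 2 * qform B w = 0]; the sign [s] makes this
   equation solvable for [r]. *)
pose k := - 2 * bform B u v / qform B w.
have k0 : k != 0 by rewrite !mulf_neq0 ?invr_eq0 // oppr_eq0 pnatr_eq0.
pose s := Num.sg k; pose r := Num.sqrt `|k|.
have s2 : s ^+ 2 = 1 by rewrite /s sqr_sg k0.
have r2 : r ^+ 2 = s * k by rewrite sqr_sqrtr // normrEsg.
have Fsv : 0 < qform F (s *: v) by rewrite qformZ s2 mul1r.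
have [t Ft] := @conic_ivt F u (s *: v) (r *: w) symF Fu Fsv.
exists (conic u (s *: v) (r *: w) t); split => //.
- by rewrite /conic !dotDr !dotZr lu lv lw !mulr0 !addr0.
(* [u] sees only the [v]-component of the arc, so a zero of the arc forces
   [t = 0], where the arc is at [u]. *)
- apply/eqP => x0.
  have : bform B u (conic u (s *: v) (r *: w) t) = 0.
    by rewrite x0 -(scale0r u) bformZr mul0r.
  rewrite /conic !bformDr !bformZr uw -qformE Bu !mulr0 add0r addr0.
  move/eqP; rewrite !mulf_eq0 (negPf Buv) orbF sgr_eq0 (negPf k0) orbF.
  rewrite orbb => /eqP t0; move: Ft.
  rewrite /conic t0 expr0n /= mul0r !scale0r !addr0 subr0 expr1n scale1r.
  by move=> Fu0; rewrite Fu0 ltxx in Fu.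
- rewrite qform_lin3 // !qformZ !bformZr !bformZl Bu Bv uw vw r2.
  rewrite [_ * _ * qform B w](_ : _ =
    - 2 * s * bform B u v); last by rewrite /k; field.
  ring.
Qed.

End IsotropicCone.

(** * Algebraic separation of convex sets *)

Section Separation.
Variables (R : realType) (n : nat).
Implicit Types (C U V : set 'cV[R]_n) (x y d : 'cV[R]_n).

(** Openness along lines. For convex sets in finite dimension it coincides
    with topological openness, and it is directly checked on polynomial
    inequalities. *)
Definition linearly_open C := forall x d, C x ->
  exists2 e : R, 0 < e & forall t, `|t| <= e -> C (x + t *: d).

Lemma linearly_open_forall (I : finType) (C : I -> set 'cV[R]_n) :
  (forall i, linearly_open (C i)) -> linearly_open [set x | forall i, C i x].
Proof.
move=> oC x d Cx.
have /choice[e He] i : exists e, 0 < e /\ forall t, `|t| <= e -> C i (x + t *: d).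
  by have [e e0 He] := oC i x d (Cx i); exists e.
exists (\big[Num.min/1]_i e i).
  by apply/bigmin_gtP; split=> // i _; case: (He i).
by move=> t /bigmin_geP[_ te] i; case: (He i) => _; apply; exact: te.
Qed.

(** The radius is chosen so that [|t| <= 1], which bounds the quadratic term
    by the same multiple of [|t|] as a linear one. *)
Lemma linearly_open_lt0 (f : 'cV[R]_n -> R) :
  (forall x d, exists b c, forall t, f (x + t *: d) = f x + t * b + t ^+ 2 * c) ->
  linearly_open [set x | f x < 0].
Proof.
move=> quad_f x d /= fx; have [b [c fE]] := quad_f x d.
pose s := `|b| + `|c|.
have s0 : 0 <= s by rewrite addr_ge0.
have D0 : 0 < s - f x by lra.
exists (- f x / (s - f x)) => [|t]; first by rewrite divr_gt0 // oppr_gt0.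
rewrite ler_pdivlMr // fE => ht.
have t1 : `|t| <= 1 by rewrite -(ler_pM2r D0); lra.
have tb : t * b <= `|t| * `|b| by rewrite -normrM ler_norm.
have tc : t ^+ 2 * c <= `|t| * `|c|.
  apply: le_trans (ler_norm _) _; rewrite normrM normrX expr2.
  by rewrite ler_wpM2r // ler_piMl.
have [t0|t0] := eqVneq `|t| 0.
  by move: tb tc; rewrite t0 !mul0r; lra.
have : 0 < `|t| by rewrite lt_def t0 normr_ge0.
rewrite /s in ht; nra.
Qed.

Lemma convex_setP C : @convex_set R 'cV[R]_n C <->
  forall x y (a b : R), 0 <= a -> 0 <= b -> a + b = 1 -> C x -> C y ->
    C (a *: x + b *: y).
Proof.
split=> [cC x y a b a0 b0 ab1 Cx Cy|cC x y t].
  have a01 : 0 <= a <= 1 by lra.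
  have := cC x y (@Itv01 R a (proj1 (andP a01)) (proj2 (andP a01))).
  rewrite !inE => /(_ Cx Cy); congr C.
  rewrite (_ : b = 1 - a) //; lra.
rewrite !inE => Cx Cy; apply: cC => //; rewrite ?ge0 //.
  by rewrite subr_ge0 le1.
by rewrite /= addrC subrK.
Qed.

(** Connectedness of a segment: the supremum of the parameters in [U] lies
    neither in [U] nor in [V]. *)
Lemma segment_not_covered U V x y : linearly_open U -> linearly_open V ->
  (forall z, U z -> V z -> False) -> U x -> V y ->
  exists t, [/\ 0 <= t, t <= 1, ~ U ((1 - t) *: x + t *: y)
              & ~ V ((1 - t) *: x + t *: y)].
Proof.
move=> oU oV UV Ux Vy.
pose g t := (1 - t) *: x + t *: y.
have gD s t : g (s + t) = g s + t *: (y - x).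
  rewrite /g scalerBr; apply/matrixP => i j; rewrite !mxE; ring.
have g0 : g 0 = x by rewrite /g subr0 scale1r scale0r addr0.
have g1 : g 1 = y by rewrite /g subrr scale1r scale0r add0r.
pose E := [set t : R | [/\ 0 <= t, t <= 1 & U (g t)]].
have E0 : E 0 by split; rewrite ?g0 ?ler01 ?lexx.
have ubE : ubound E 1 by move=> t [].
have supE : has_sup E by split; [exists 0 | exists 1].
set s := sup E.
have s0 : 0 <= s by apply: ub_le_sup => //; exists 1.
have s1 : s <= 1 by apply: ge_sup => //; exists 0.
exists s; split=> //; rewrite -/(g s); [move=> Us|move=> Vs].
  have [e e0 He] := oU (g s) (y - x) Us.
  have s_lt1 : s < 1.
    rewrite lt_neqAle s1 andbT; apply/eqP => s_eq1.
    by move: Us; rewrite s_eq1 g1 => Uy; exact: UV Uy Vy.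
  pose t := Num.min e (1 - s).
  have t0 : 0 < t by rewrite lt_min e0 subr_gt0.
  have : E (s + t).
    split; first by rewrite addr_ge0 // ltW.
      by rewrite -lerBrDl ge_min lexx orbT.
    by rewrite gD; apply: He; rewrite gtr0_norm // ge_min lexx.
  move/(ub_le_sup (ex_intro _ 1 ubE)); rewrite -/s; lra.
have [e e0 He] := oV (g s) (y - x) Vs.
have [t Et st] := sup_adherent e0 supE.
have ts : t <= s by apply: ub_le_sup => //; exists 1.
have : V (g t).
  rewrite (_ : t = s + (t - s)); last by ring.
  by rewrite gD; apply: He; rewrite ler0_norm; move: st; rewrite -/s; lra.
by case: Et => _ _ Ut; exact: UV Ut.
Qed.

(** Strict separation of an open convex set from the origin. For a nonempty
    [C], take a linear subspace [L] of maximal dimension that avoids [C] and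
    let [M] be the open convex cone generated by [C + L]. By maximality every
    vector outside [L] lies in [M] or in [-M], as it could be added to [L]
    otherwise. If [L] had codimension at least 2, a segment from [M] to [-M]
    could be drawn outside [L], and it would be covered by two disjoint open
    sets. So [L] is a hyperplane, and a linear function vanishing on [L] has a
    constant sign on [C]. *)
Lemma separation C :
  @convex_set R 'cV[R]_n C -> linearly_open C -> ~ C 0 ->
  exists l : 'cV[R]_n, forall x, C x -> 0 < dot l x.
Proof.
move=> /convex_setP cC oC C0.
have [[x0 Cx0]|Cempty] := pselect (exists x, C x); last first.
  by exists 0 => x Cx; case: Cempty; exists x.
pose disj (L : 'M[R]_n) := forall x, C x -> ~~ (x^T <= L)%MS.
pose P k := `[< exists2 L, disj L & \rank L = k >].
have P0 : exists k, P k.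
  exists 0%N; apply/asboolP; exists 0; last exact: mxrank0.
  move=> x Cx; rewrite submx0 trmx_eq0; apply/eqP => x_eq0.
  by rewrite x_eq0 in Cx.
have Pn k : P k -> (k <= n)%N by move=> /asboolP[L _ <-]; exact: rank_leq_col.
have [k /asboolP[L disjL rankL] maxk] := ex_maxnP P0 Pn.
have rankLn : (n <= k.+1)%N.
  rewrite leqNgt; apply/negP => kn.
  pose M x := exists s y, [/\ 0 < s, C y & ((x - s *: y)^T <= L)%MS].
  have oM : linearly_open M.
    move=> x d [s [y [s0 Cy xyL]]]; have [e e0 He] := oC y d Cy.
    exists (e * s) => [|t te]; first exact: mulr_gt0.
    exists s, (y + (t / s) *: d); split => //.
      by apply: He; rewrite normrM normfV (gtr0_norm s0) ler_pdivrMr.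
    congr (_ <= _)%MS : xyL; congr (_^T).
    rewrite scalerDr scalerA mulrCA divff ?gt_eqF // mulr1.
    by rewrite opprD addrACA subrr addr0.
  have oN : linearly_open (fun x => M (- x)).
    move=> x d /oM => /(_ (- d))[e e0 He]; exists e => // t /He.
    by rewrite scalerN opprD.
  have MN x : M x -> M (- x) -> False.
    move=> [s [y [s0 Cy xyL]]] [s' [y' [s'0 Cy' xyL']]].
    have ss0 : s + s' != 0 by rewrite gt_eqF // addr_gt0.
    have /(disjL _)/negP : C ((s / (s + s')) *: y + (s' / (s + s')) *: y').
      by apply: cC => //; rewrite ?divr_ge0 ?addr_ge0 // ?ltW // -mulrDl divff.
    apply.
    have -> : (s / (s + s')) *: y + (s' / (s + s')) *: y' =
        (- (s + s')^-1) *: ((x - s *: y) + (- x - s' *: y')).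
      by apply/matrixP => i j; rewrite !mxE; field.
    by rewrite linearZ linearD /= scalemx_sub // addmx_sub.
  have cover x : ~~ (x^T <= L)%MS -> M x \/ M (- x).
    move=> xL; pose L' := (L + x^T)%MS.
    have rL' : (k < \rank L')%N.
      rewrite -rankL; apply: rank_ltmx; rewrite ltmxE addsmxSl /=.
      by apply: contra xL => /(submx_trans (addsmxSr _ _)).
    have : ~ disj L'.
      move=> dL'; have /maxk : P (\rank L') by apply/asboolP; exists L'.
      by rewrite leqNgt rL'.
    move=> /existsNP[y] /not_implyP[Cy] /negP; rewrite negbK => /sub_addsmxP.
    move=> [[u1 u2] /= yE].
    pose c := u2 0 0.
    have yc : ((y - c *: x)^T <= L)%MS.
      rewrite linearB linearZ /= yE [u2]mx11_scalar mul_scalar_mx.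
      by rewrite addrK submxMl.
    have [c0|c0|c0] := ltgtP c 0.
    - right; exists (- c^-1), y; split => //; first by rewrite oppr_gt0 invr_lt0.
      rewrite (_ : _ - _ = c^-1 *: (y - c *: x)).
        by rewrite linearZ scalemx_sub.
      rewrite scalerBr scalerA mulVf ?lt_eqF // scale1r scaleNr opprK.
      by rewrite addrC.
    - left; exists (c^-1), y; split => //; first by rewrite invr_gt0.
      rewrite (_ : _ - _ = - c^-1 *: (y - c *: x)).
        by rewrite linearZ scalemx_sub.
      rewrite scalerBr scalerA mulNr mulVf ?gt_eqF // scaleN1r scaleNr opprK.
      by rewrite addrC.
    - by move: yc; rewrite c0 scale0r subr0 (negPf (disjL _ Cy)).
  (* A direction independent of [x0] modulo [L] keeps the segment outside [L]. *)
  have [w wL] : exists w : 'cV[R]_n, ~~ (w^T <= L + x0^T)%MS.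
    have : ~~ (1%:M <= L + x0^T)%MS.
      apply/negP => /mxrankS; rewrite mxrank1 leqNgt => /negP; apply.
      apply: leq_ltn_trans (mxrank_adds_leqif _ _) _.
      rewrite rankL; apply: leq_ltn_trans kn; rewrite -[k.+1]addn1 leq_add2l.
      exact: rank_leq_row.
    by case/row_subPn => i iL; exists (row i 1%:M)^T; rewrite trmxK.
  have Mx0 : M x0.
    by exists 1, x0; split => //; rewrite scale1r subrr linear0 sub0mx.
  have [w' w'L Mw'] : exists2 w' : 'cV[R]_n, ~~ (w'^T <= L + x0^T)%MS & M (- w').
    have [|Mw|Mw] := cover w; last by exists w.
      by apply: contra wL => /submx_trans; apply; exact: addsmxSl.
    by exists (- w); rewrite ?opprK // linearN /= eqmx_opp.
  have [t [t0 t1 tM tN]] := segment_not_covered oM oN MN Mx0 Mw'.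
  have [|//|//] := cover ((1 - t) *: x0 + t *: w').
  rewrite linearD !linearZ /=.
  have [->|tn0] := eqVneq t 0.
    by rewrite subr0 scale1r scale0r addr0 disjL.
  apply: contra w'L => tL.
  rewrite (_ : w'^T = t^-1 *: (((1 - t) *: x0^T + t *: w'^T) - (1 - t) *: x0^T)).
    rewrite scalemx_sub // addmx_sub //.
      by apply: submx_trans tL _; exact: addsmxSl.
    by rewrite -scaleNr scalemx_sub // addsmxSr.
  by rewrite addrC addKr scalerA mulVf // scale1r.
have [l l0 Ll] : exists2 l : 'cV[R]_n, l != 0 & L *m l = 0.
  have : kermx L^T != 0.
    rewrite -mxrank_eq0 mxrank_ker mxrank_tr -lt0n subn_gt0 ltn_neqAle.
    rewrite rank_leq_col andbT; apply: contra (disjL _ Cx0) => rL.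
    by apply: submx_full.
  case/rowV0Pn => v /sub_kermxP vL v0; exists v^T; first by rewrite trmx_eq0.
  by apply: trmx_inj; rewrite trmx_mul trmxK vL trmx0.
have Ceq0 x : C x -> dot l x <> 0.
  move=> /disjL/negP xL lx; apply: xL.
  have kerL : (kermx l <= L)%MS.
    have -> : (kermx l <= L)%MS = (\rank (kermx l) <= \rank L)%N.
      apply/idP/idP; first exact: mxrankS.
      move=> rk; rewrite -(geq_leqif (mxrank_leqif_sup _)) //.
      by apply/sub_kermxP.
    rewrite mxrank_ker rankL leq_subLR (leq_trans rankLn) // -add1n leq_add2r.
    by rewrite lt0n mxrank_eq0.
  apply: submx_trans kerL; apply/sub_kermxP; rewrite [LHS]mx11_scalar.
  by rewrite -/(dot x l) dotC lx raddf0.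
have same_sign x y : C x -> C y -> 0 < dot l x -> 0 < dot l y.
  move=> Cx Cy lx; rewrite ltNge; apply/negP => ly.
  pose D := dot l x - dot l y.
  have D0 : 0 < D by rewrite /D; lra.
  apply: (@Ceq0 ((- dot l y / D) *: x + (dot l x / D) *: y)).
    apply: cC => //; rewrite ?divr_ge0 ?oppr_ge0 // ?ltW //.
    by rewrite -mulrDl addrC divff // gt_eqF.
  by rewrite dotDr !dotZr; ring.
have [lx0|lx0|] := ltgtP 0 (dot l x0).
- by exists l => x Cx; apply: (same_sign x0).
- exists (- l) => x Cx; rewrite dotNl oppr_gt0 ltNge; apply/negP.
  rewrite le_eqVlt => /orP[/eqP/esym/(Ceq0 _ Cx)//|lx].
  by have := same_sign _ _ Cx Cx0 lx; rewrite ltNge ltW.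
- by move/esym/(Ceq0 _ Cx0).
Qed.

Lemma linearly_open_qform_lt0 (Q : 'M[R]_n) : Q^T = Q ->
  linearly_open [set x | qform Q x < 0].
Proof.
move=> symQ; apply: linearly_open_lt0 => x d.
exists (2 * bform Q x d), (qform Q d) => t.
by rewrite -[x in LHS]scale1r qform_lin2 //; ring.
Qed.


End Separation.

Section ConvexHull.
Variables (R : realType) (n : nat).
Implicit Types (S C : set 'cV[R]_n).

Lemma conv_hull_convex S : @convex_set R 'cV[R]_n (conv_hull S).
Proof.
apply/convex_setP => x y a b a0 b0 ab1 Sx Sy C [cC SC].
by apply: (convex_setP C).1 => //; [exact: Sx | exact: Sy].
Qed.

Lemma conv_hull_sub S C :
  @convex_set R 'cV[R]_n C -> S `<=` C -> conv_hull S `<=` C.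
Proof. by move=> cC SC x; apply. Qed.

Lemma sub_conv_hull S : S `<=` conv_hull S.
Proof. by move=> x Sx C [_]; apply. Qed.

Lemma linearly_open_conv_hull S : linearly_open S -> linearly_open (conv_hull S).
Proof.
move=> oS x d Sx; move: x Sx d.
apply: conv_hull_sub => [|x Sx d]; last first.
  have [e e0 He] := oS x d Sx; exists e => // t /He; exact: sub_conv_hull.
apply/convex_setP => x y a b a0 b0 ab1 Cx Cy d.
have [e e0 He] := Cx d; have [e' e'0 He'] := Cy d.
exists (Num.min e e') => [|t]; first by rewrite lt_min e0.
rewrite le_min => /andP[te te'].
rewrite [_ + t *: d](_ : _ = a *: (x + t *: d) + b *: (y + t *: d)).
  have /convex_setP := @conv_hull_convex S; apply => //.
    exact: He.
  exact: He'.
by rewrite !scalerDr addrACA -scalerDl ab1 scale1r.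
Qed.

End ConvexHull.

(** * Symmetric matrices with at most one negative eigenvalue *)

Lemma char_poly_conj (F : fieldType) n (P A B : 'M[F]_n) :
  P \in unitmx -> P *m A = B *m P -> char_poly A = char_poly B.
Proof.
move=> uP PA; rewrite /char_poly /char_poly_mx.
pose Pp := map_mx (@polyC F) P.
have Pp0 : \det Pp != 0 by rewrite det_map_mx polyC_eq0 -unitfE -unitmxE.
apply: (mulfI Pp0); rewrite [RHS]mulrC -!det_mulmx mulmxBr mulmxBl.
by rewrite -!map_mxM PA scalar_mxC.
Qed.

Section NegativeEigenvalues.
Variables (R : realType) (n : nat).
Implicit Types (A : 'M[R]_n) (u : 'cV[R]_n).

(** The orthogonal of an eigenvector of a symmetric matrix is stable, so the
    matrix is block diagonal in a basis made of [u] and a basis of that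
    orthogonal. The rows of [N] are the latter basis and [B] is the matrix
    induced on it. *)
Lemma char_poly_deflate A u a : A^T = A -> u != 0 -> A *m u = a *: u ->
  exists r (N : 'M[R]_(r, n)) (B : 'M[R]_r),
    [/\ row_free N, N *m u = 0, N *m A = B *m N
      & char_poly A = ('X - a%:P) * char_poly B].
Proof.
move=> symA u0 Au.
have uA : u^T *m A = a *: u^T by rewrite -[A]symA -trmx_mul Au linearZ.
pose r : nat := \rank (kermx u); pose N : 'M[R]_(r, n) := row_base (kermx u).
have Nu : N *m u = 0 by apply/sub_kermxP; rewrite eq_row_base.
have freeN : row_free N by exact: row_base_free.
have /submxP[B NA] : (N *m A <= N)%MS.
  rewrite eq_row_base; apply/sub_kermxP.
  by rewrite -mulmxA Au -scalemxAr Nu scaler0.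
clearbody N.
have rE : n = (1 + r)%N.
  rewrite /r mxrank_ker.
  have /eqP -> : \rank u == 1%N.
    by rewrite eqn_leq rank_leq_col lt0n mxrank_eq0.
  rewrite subnKC // lt0n; apply: contraNneq u0 => n0.
  by apply/eqP/matrixP => i; have := ltn_ord i; rewrite [X in (_ < X)%N]n0.
clearbody r.
exists r, N, B; split => //.
move: A u symA u0 Au uA N Nu freeN NA.
rewrite rE => {rE} A u _ u0 _ uA N Nu freeN NA.
pose P := col_mx u^T N.
have uP : P \in unitmx.
  have ru : \rank u^T = 1%N.
    by apply/eqP; rewrite mxrank_tr eqn_leq rank_leq_col lt0n mxrank_eq0.
  rewrite -row_free_unit /row_free -addsmxE -[X in _ == (X + _)%N]ru.
  rewrite -[X in _ == (_ + X)%N](eqP freeN).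
  apply/eqP; apply/mxrank_disjoint_sum; apply/eqP/rowV0P => v.
  rewrite sub_capmx => /andP[/submxP[c ->] /submxP[d cu]].
  have : (c *m u^T) *m u = 0 by rewrite cu -mulmxA Nu mulmx0.
  rewrite -mulmxA [u^T *m u]mx11_scalar -/(dot u u) mul_mx_scalar.
  move/eqP; rewrite scaler_eq0 gt_eqF ?dot_gt0 //= => /eqP ->.
  by rewrite mul0mx.
rewrite (@char_poly_conj _ _ P A (block_mx a%:M 0 0 B)) //; last first.
  rewrite mul_col_mx mul_block_col uA NA !mul0mx addr0 add0r.
  by rewrite mul_scalar_mx.
rewrite /char_poly /char_poly_mx map_block_mx /= !map_mx0 scalar_mx_block.
rewrite opp_block_mx add_block_mx !oppr0 !addr0 det_ublock; congr (_ * _).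
by rewrite map_scalar_mx -raddfB det_scalar1.
Qed.

(** Two vectors orthogonal for [A] and with negative values would span a plane
    on which [A] is negative definite, and a plane meets every hyperplane
    outside 0. *)
Lemma one_negative_direction A l u v : A^T = A ->
  (forall x, dot l x = 0 -> 0 <= qform A x) ->
  qform A u < 0 -> bform A u v = 0 -> 0 <= qform A v.
Proof.
move=> symA psd Au Auv; rewrite leNgt; apply/negP => Av.
have := psd ((dot l v) *: u + (- dot l u) *: v).
rewrite dotDr !dotZr mulNr mulrC subrr => /(_ erefl).
rewrite qform_lin2 // Auv mulr0 addr0 sqrrN.
have [lv|lv] := eqVneq (dot l v) 0.
  by have := psd v lv; rewrite leNgt Av.
have : 0 < dot l v ^+ 2 by rewrite exprn_even_gt0 //= lv.
have : 0 <= dot l u ^+ 2 by apply: sqr_ge0.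
nra.
Qed.

(** Given a negative eigenvalue [a], the matrix induced on the orthogonal of
    its eigenvector has no negative eigenvalue left by
    [one_negative_direction], so [a] is the only negative root of the
    characteristic polynomial and it is a simple one. *)
Lemma num_neg_eigenvalues_le1 A l : A^T = A ->
  (forall x, dot l x = 0 -> 0 <= qform A x) ->
  (num_neg_eigenvalues A <= 1)%N.
Proof.
move=> symA psd; rewrite /num_neg_eigenvalues.
have [[a a0 rootA]|noroot] :=
    pselect (exists2 a, a < 0 & root (char_poly A) a); last first.
  rewrite fsbig1 // => a a0; apply: mupNroot; apply/negP => ra.
  by apply: noroot; exists a.
have [u u0 Au] : exists2 u : 'cV[R]_n, u != 0 & A *m u = a *: u.
  move: rootA; rewrite -eigenvalue_root_char => /eigenvalueP[v vA v0].
  exists v^T; first by rewrite trmx_eq0.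
  by apply: trmx_inj; rewrite trmx_mul trmxK symA vA linearZ /= trmxK.
have [r [N [B [freeN Nu NA charA]]]] := char_poly_deflate symA u0 Au.
have Au_lt0 : qform A u < 0.
  by rewrite qformE /bform -mulmxA Au -scalemxAr mxE nmulr_rlt0 // dot_gt0.
have rootB b : b < 0 -> ~~ root (char_poly B) b.
  move=> b0; apply/negP; rewrite -eigenvalue_root_char => /eigenvalueP[y yB y0].
  pose v := (y *m N)^T.
  have v0 : v != 0 by rewrite trmx_eq0 mulmx_free_eq0.
  have Av : A *m v = b *: v.
    rewrite /v; apply: trmx_inj; rewrite trmx_mul trmxK symA -mulmxA NA mulmxA.
    by rewrite yB linearZ /= trmxK scalemxAl.
  have uv : dot u v = 0 by rewrite dotC /dot trmxK -mulmxA Nu mulmx0 mxE.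
  have : 0 <= qform A v.
    apply: (one_negative_direction symA psd Au_lt0).
    by rewrite /bform -mulmxA Av -scalemxAr mxE -/(dot u v) uv mulr0.
  rewrite qformE /bform -mulmxA Av -scalemxAr mxE leNgt nmulr_rlt0 //.
  by rewrite -/(dot v v) dot_gt0.
rewrite -(fsbig_widen [set a]); last 2 first.
- by move=> _ ->.
- move=> b [/= b0 ba]; rewrite charA; apply: mupNroot.
  by rewrite rootM root_XsubC (negPf (rootB b b0)) orbF; apply/eqP.
rewrite fsbig_set1 charA mupMl ?rootB //.
by rewrite -['X - _]expr1 mup_XsubCX eqxx.
Qed.

End NegativeEigenvalues.

(** * Three quadratic forms with a positive definite combination *)

Section CrossProduct.
Variable R : realType.
Implicit Types a b c : 'cV[R]_3.

(** Indices are taken modulo 3 through the ring structure of ['I_3], which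
    gives the three coordinates by one formula. *)
Definition cross a b : 'cV[R]_3 :=
  \col_i (a (i + 1) 0 * b (i + 2) 0 - a (i + 2) 0 * b (i + 1) 0).

Lemma sum3 (F : 'I_3 -> R) : \sum_i F i = F 0 + F 1 + F 2.
Proof.
rewrite !big_ord_recl big_ord0 addr0 addrA.
by congr (_ + F _ + F _); apply: val_inj.
Qed.

Lemma ord3P (P : 'I_3 -> Prop) : P 0 -> P 1 -> P 2 -> forall i, P i.
Proof.
move=> P0 P1 P2 [[|[|[|//]]] Hi].
- by rewrite (_ : Ordinal Hi = 0) //; apply: val_inj.
- by rewrite (_ : Ordinal Hi = 1) //; apply: val_inj.
- by rewrite (_ : Ordinal Hi = 2) //; apply: val_inj.
Qed.

Lemma ord3D : (((0 + 1)%R = 1%R :> 'I_3) * ((0 + 2)%R = 2%R :> 'I_3) *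
  ((1 + 1)%R = 2%R :> 'I_3) * ((1 + 2)%R = 0%R :> 'I_3) *
  ((2 + 1)%R = 0%R :> 'I_3) * ((2 + 2)%R = 1%R :> 'I_3))%type.
Proof. by do !split; apply: val_inj. Qed.

Lemma cross_cross a b c :
  cross a (cross b c) = dot a c *: b - dot a b *: c.
Proof.
apply/colP; apply: ord3P; rewrite !(mxE, ord3D, dotE, sum3); ring.
Qed.

Lemma dot_cross a b c : dot (cross a b) c = dot a (cross b c).
Proof. by rewrite !dotE !sum3 !mxE !ord3D; ring. Qed.

Lemma crossDr a b c : cross a (b + c) = cross a b + cross a c.
Proof. by apply/colP; apply: ord3P; rewrite !(mxE, ord3D); ring. Qed.

Lemma crossC a b : cross a b = - cross b a.
Proof. by apply/colP; apply: ord3P; rewrite !(mxE, ord3D); ring. Qed.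

Lemma crossvv a : cross a a = 0.
Proof. by apply/colP; apply: ord3P; rewrite !(mxE, ord3D); ring. Qed.

Lemma crossZr k a b : cross a (k *: b) = k *: cross a b.
Proof. by apply/colP; apply: ord3P; rewrite !(mxE, ord3D); ring. Qed.

(** Vectors with zero cross product are proportional; the coefficient is
    expressed through [t], which will be positive on the vectors at hand. *)
Lemma cross_eq0 t a b : cross a b = 0 -> dot t a *: b = dot t b *: a.
Proof.
move=> ab; have := cross_cross t a b; rewrite ab -(scale0r 0) crossZr scale0r.
by move/esym/eqP; rewrite subr_eq0 => /eqP ->.
Qed.

End CrossProduct.

Section ThreeForms.
Variables (R : realType) (m : nat) (P : 'I_3 -> 'M[R]_m).

Definition joint_value (v : 'cV[R]_m) : 'cV[R]_3 := \col_i qform (P i) v.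

Definition combination (a : 'cV[R]_3) : 'M[R]_m := \sum_i a i 0 *: P i.

Lemma qform_combination a v : qform (combination a) v = dot a (joint_value v).
Proof.
rewrite qformE /combination (bform_sum (fun i => a i 0)) dotE.
by apply: eq_bigr => i _; rewrite mxE.
Qed.

Lemma joint_valueZ k v : joint_value (k *: v) = k ^+ 2 *: joint_value v.
Proof. by apply/colP => i; rewrite !mxE qformZ. Qed.

Hypothesis symP : forall i, (P i)^T = P i.

Lemma combination_sym a : (combination a)^T = combination a.
Proof.
by rewrite linear_sum /=; apply: eq_bigr => i _; rewrite linearZ /= symP.
Qed.

Variables (l : 'cV[R]_m) (t : 'cV[R]_3).
Hypothesis m4 : (4 <= m)%N.
Hypothesis pos_t : forall v, v != 0 -> 0 < qform (combination t) v.

(** The joint image of the hyperplane orthogonal to [l] is closed under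
    addition, hence a convex cone. With [p] and [q] the two values, [mu] is
    the functional that vanishes on their plane, and [f] is one that vanishes
    at [p + q] and has opposite signs at [p] and [q]. A common zero of [mu]
    and [f] in the joint image lies on the line of [p + q], and positivity of
    [t] puts it on the right half of that line. *)
Lemma joint_value_add u v : dot l u = 0 -> dot l v = 0 ->
  exists2 x, dot l x = 0 & joint_value x = joint_value u + joint_value v.
Proof.
move=> lu lv.
have jv0 : joint_value 0 = 0.
  by rewrite -(scale0r 0) joint_valueZ expr0n /= !scale0r.
have [->|u0] := eqVneq u 0; first by exists v; rewrite // jv0 add0r.
have [->|v0] := eqVneq v 0; first by exists u; rewrite // jv0 addr0.
set p := joint_value u; set q := joint_value v; pose d := p + q.
have td : 0 < dot t d.
  by rewrite dotDr addr_gt0 // -qform_combination pos_t.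
have enough x : dot l x = 0 -> x != 0 -> cross (joint_value x) d = 0 ->
    exists2 x, dot l x = 0 & joint_value x = d.
  move=> lx /pos_t; rewrite qform_combination => tx /(cross_eq0 t) xd.
  exists (Num.sqrt (dot t d / dot t (joint_value x)) *: x).
    by rewrite dotZr lx mulr0.
  rewrite joint_valueZ sqr_sqrtr ?divr_ge0 // ?ltW //.
  by rewrite mulrC -scalerA -xd scalerA mulVf ?scale1r // gt_eqF.
pose mu := cross p q.
have [mu0|mu0] := eqVneq mu 0.
  by apply: (enough u); rewrite // crossDr crossvv add0r.
pose f := cross mu d.
have dp : cross d p = - mu by rewrite crossC crossDr crossvv add0r.
have dq : cross d q = mu.
  by rewrite crossC crossDr crossvv addr0 -crossC.
have mup : dot mu p = 0 by rewrite dotC -dot_cross crossvv dotC dot0r.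
have muq : dot mu q = 0 by rewrite dot_cross crossvv dot0r.
have mud : dot mu d = 0 by rewrite dotDr mup muq addr0.
have [||||x [lx x0 fx mux]] := @isotropic_ivt _ _ l (combination f)
    (combination mu) u v m4 (combination_sym _) (combination_sym _) lu lv.
- rewrite qform_combination dot_cross dp.
  by rewrite dotC dotNl oppr_lt0 dot_gt0.
- by rewrite qform_combination dot_cross dq dot_gt0.
- by rewrite qform_combination.
- by rewrite qform_combination.
apply: (enough x) => //.
have := cross_cross (joint_value x) mu f.
rewrite dotC -qform_combination fx dotC -qform_combination mux !scale0r subr0.
rewrite [cross mu f]cross_cross mud scale0r sub0r -scaleNr crossZr => /eqP.
by rewrite scaler_eq0 oppr_eq0 gt_eqF ?dot_gt0 //= => /eqP.
Qed.

(** A theorem of alternatives: if the forms have no common negative vector on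
    the hyperplane, some nonzero nonnegative combination of them is
    nonnegative there. Adding the open positive orthant to the joint image
    gives an open convex set avoiding 0, to which [separation] applies. *)
Lemma nonneg_multipliers :
  (forall v, dot l v = 0 -> exists i, 0 <= qform (P i) v) ->
  exists a : 'cV[R]_3, [/\ forall i, 0 <= a i 0, a != 0
    & forall v, dot l v = 0 -> 0 <= qform (combination a) v].
Proof.
move=> noneg.
pose C := [set z : 'cV[R]_3 |
  exists2 v, dot l v = 0 & forall i, joint_value v i 0 < z i 0].
have cC : @convex_set R 'cV[R]_3 C.
  apply/convex_setP => x y a b a0 b0 ab [u lu ux] [v lv vy].
  have [||w lw wE] := @joint_value_add (Num.sqrt a *: u) (Num.sqrt b *: v).
  - by rewrite dotZr lu mulr0.
  - by rewrite dotZr lv mulr0.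
  exists w => // i; rewrite wE !joint_valueZ !sqr_sqrtr //.
  rewrite [X in X < _]mxE [X in _ < X]mxE !(mxE _ _ i 0) -?joint_valueZ.
  have [a_eq0|a_neq0] := eqVneq a 0.
    have b1 : b = 1 by lra.
    by rewrite a_eq0 b1 !mul0r !mul1r !add0r; have := vy i; rewrite mxE.
  apply: ltr_leD; last by rewrite ler_wpM2l // ltW //; have := vy i; rewrite mxE.
  rewrite ltr_pM2l; last by rewrite lt_def a_neq0.
  by have := ux i; rewrite mxE.
have oC : linearly_open C.
  move=> x d [v lv vx].
  pose Cv i := [set z : 'cV[R]_3 | joint_value v i 0 - z i 0 < 0].
  have oCv i : linearly_open (Cv i).
    apply: linearly_open_lt0 => z z'.
    by exists (- z' i 0), 0 => s; rewrite !mxE; ring.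
  have [|e e0 He] := linearly_open_forall oCv (x := x) d.
    by move=> i; rewrite /Cv /= subr_lt0.
  exists e => // s /He Hs; exists v => // i.
  by have := Hs i; rewrite /Cv /= subr_lt0.
have C0 : ~ C 0.
  move=> [v lv]; have [i vi] := noneg v lv => /(_ i).
  by rewrite !mxE ltNge vi.
have [a aC] := separation cC oC C0.
(* The value 0 is in the joint image, so [C] contains the positive orthant. *)
have one0 : C (const_mx 1).
  exists 0; first by rewrite -(scale0r 0) dotZr mul0r.
  by move=> i; rewrite mxE -(scale0r 0) qformZ mxE expr0n mul0r ltr01.
exists a; split.
- move=> i; rewrite leNgt; apply/negP => ai.
  (* At this [T] the functional [a] vanishes at a point of the orthant. *)
  pose T := dot a (const_mx 1) / - a i 0.
  have T0 : 0 <= T.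
    by rewrite divr_ge0 ?oppr_ge0 // ltW // aC.
  have : C (const_mx 1 + T *: delta_mx i 0).
    exists 0; first by rewrite -(scale0r 0) dotZr mul0r.
    move=> j; rewrite mxE -(scale0r 0) qformZ !mxE expr0n mul0r.
    by rewrite ltr_pwDl // mulr_ge0.
  move/aC; rewrite dotDr dotZr [dot a (delta_mx _ _)]dotE (bigD1 i) //=.
  rewrite big1 => [|j ji]; last by rewrite mxE (negPf ji) mulr0.
  rewrite mxE !eqxx mulr1 addr0 /T invrN mulrN mulNr mulfVK ?lt_eqF //.
  by rewrite subrr ltxx.
- apply/eqP => a0; have := aC _ one0.
  by rewrite a0 dotE big1 ?ltxx // => i _; rewrite mxE mul0r.
- move=> v lv; rewrite qform_combination; apply/ler_addgt0Pr => e e0.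
  have s0 := aC _ one0.
  have : C (joint_value v + (e / dot a (const_mx 1)) *: const_mx 1).
    exists v => // i; rewrite [X in _ < X]mxE ltrDl !mxE mulr1.
    exact: divr_gt0.
  by move/aC; rewrite dotDr dotZr mulfVK ?gt_eqF // => /ltW.
Qed.

End ThreeForms.

(** * Aggregated inequalities *)

Section Homogenization.
Variables (R : realType) (n : nat).

Lemma dot_col_mx (a x : 'cV[R]_n) (b c : R) :
  dot (col_mx a b%:M) (col_mx x c%:M) = dot a x + b * c.
Proof.
by rewrite /dot tr_col_mx mul_row_col tr_scalar_mx -scalar_mxM !mxE eqxx mulr1n.
Qed.

Lemma qform_homogenize (Q : 'M[R]_(n + 1)) (x : 'cV[R]_n) (s : R) : s != 0 ->
  qform Q (col_mx x s%:M) = s ^+ 2 * qform Q (col_mx (s^-1 *: x) 1%:M).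
Proof.
move=> s0; rewrite -qformZ scale_col_mx scalerA divff // scale1r.
by rewrite scale_scalar_mx mulr1.
Qed.

Lemma linearly_open_neg_set (Q : 'M[R]_(n + 1)) : Q^T = Q ->
  linearly_open (neg_set Q).
Proof.
move=> symQ; apply: linearly_open_lt0 => x d.
exists (2 * bform Q (col_mx x 1%:M) (col_mx d 0)), (qform Q (col_mx d 0)) => t.
rewrite [col_mx (x + _) _](_ : _ = 1 *: col_mx x 1%:M + t *: col_mx d 0).
  by rewrite qform_lin2 //; ring.
by rewrite scale1r scale_col_mx add_col_mx scaler0 addr0.
Qed.

(** A form that is nonnegative on a hyperplane has at most one negative
    direction, so its negative cone consists of two convex halves, one on each
    side of the hyperplane. *)
Lemma convex_neg_set_halfspace (Q : 'M[R]_(n + 1)) (l : 'cV[R]_(n + 1)) :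
  Q^T = Q -> (forall w, dot l w = 0 -> 0 <= qform Q w) ->
  @convex_set R 'cV[R]_n
    [set x | neg_set Q x /\ 0 < dot l (col_mx x 1%:M)].
Proof.
move=> symQ psd; apply/convex_setP => x y a b a0 b0 ab1 [Qx lx] [Qy ly] /=.
have B := bform_lt0 symQ psd lx ly Qx Qy.
have E : col_mx (a *: x + b *: y) 1%:M =
    a *: col_mx x 1%:M + b *: col_mx y 1%:M :> 'cV[R]_(n + 1).
  by rewrite !scale_col_mx add_col_mx -scalerDl ab1 scale1r.
rewrite /neg_set /= E qform_lin2 // dotDr !dotZr.
have [a_eq0|a_neq0] := eqVneq a 0.
  have b1 : b = 1 by lra.
  by rewrite a_eq0 b1 !(mulr0, mul0r, expr0n, expr1n, mul1r, add0r, addr0).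
have a_gt0 : 0 < a by rewrite lt_def a_neq0.
rewrite /neg_set /= in Qx Qy.
have := mulr_gt0 a_gt0 lx; have := mulr_ge0 b0 (ltW ly).
have : a ^+ 2 * qform Q (col_mx x 1%:M) < 0 by rewrite pmulr_rlt0 // exprn_gt0.
have : b ^+ 2 * qform Q (col_mx y 1%:M) <= 0.
  by rewrite mulr_ge0_le0 ?sqr_ge0 ?ltW.
have : 2 * a * b * bform Q (col_mx x 1%:M) (col_mx y 1%:M) <= 0.
  by apply: mulr_ge0_le0; [rewrite !mulr_ge0 | exact: ltW].
by move=> *; split; lra.
Qed.

End Homogenization.

Theorem theorem2 (R : realType) (n : nat) (hn : (3 <= n)%N)
    (A : 'I_3 -> 'M[R]_n) (b : 'I_3 -> 'cV[R]_n) (c : 'I_3 -> R)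
    (hA : forall i, A i \is symmetricmx)
    (hPD : exists theta : 'cV[R]_3, posdefmx (agg_mx A b c theta))
    (hconv : conv_hull (sol_set A b c) <> setT) :
  conv_hull (sol_set A b c) =
  \bigcap_(lambda in good_multipliers A b c) agg_set A b c lambda.
Proof.
have symA i : (A i)^T = A i.
  by have /is_hermitianmxP := hA i; rewrite expr0 scale1r map_mx_id // => <-.
pose P i := quad_mx (A i) (b i) (c i).
have symP i : (P i)^T = P i.
  by rewrite /P /quad_mx tr_block_mx symA trmxK tr_scalar_mx.
set S := sol_set A b c.
apply/seteqP; split => [y Sy a [_ Sa _]|y Hy]; first exact: Sa.
have [//|nSy] := pselect (conv_hull S y); exfalso.
have oS : linearly_open S.
  by apply: linearly_open_forall => i; exact: linearly_open_neg_set (symP i).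
have [|||l lP] := @separation R n [set x | conv_hull S (x + y)].
- apply/convex_setP => u v s t s0 t0 st1 /= Su Sv.
  rewrite (_ : _ + y = s *: (u + y) + t *: (v + y)).
    by have /convex_setP := @conv_hull_convex R n S; apply.
  by rewrite !scalerDr addrACA -scalerDl st1 scale1r.
- move=> x d /= /(linearly_open_conv_hull oS)-/(_ d)[e e0 He].
  by exists e => // t /He; rewrite addrAC.
- by rewrite /= add0r.
have lS x : conv_hull S x -> 0 < dot l x - dot l y.
  by move=> Sx; have := lP (x - y); rewrite /= subrK => /(_ Sx);
    rewrite dotDr -scaleN1r dotZr mulN1r.
(* The affine function [x |-> dot l (x - y)], homogenized. *)
pose L : 'cV[R]_(n + 1) := col_mx l (- dot l y)%:M.
have LE x s : dot L (col_mx x s%:M) = dot l x - dot l y * s.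
  by rewrite dot_col_mx mulNr.
have LSgt0 x : S x -> 0 < dot L (col_mx x 1%:M).
  by move=> /sub_conv_hull/lS; rewrite LE mulr1.
have colE (v : 'cV[R]_(n + 1)) : exists x s, v = col_mx x s%:M.
  exists (usubmx v), (dsubmx v 0 0).
  by rewrite -mx11_scalar vsubmxK.
have noneg (v : 'cV[R]_(n + 1)) : dot L v = 0 -> exists i, 0 <= qform (P i) v.
  move=> Lv; apply: contrapT => /forallNP noti.
  have neg i : qform (P i) v < 0.
    by have /negP := noti i; rewrite -ltNge.
  have finite_case x (s : R) : s != 0 -> dot L (col_mx x s%:M) = 0 ->
      (forall i, qform (P i) (col_mx x s%:M) < 0) -> False.
    move=> s0 Lx xneg; have : S (s^-1 *: x).
      move=> i; rewrite /neg_set /=; have := xneg i.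
      by rewrite qform_homogenize // pmulr_rlt0 // exprn_even_gt0.
    move/LSgt0; rewrite (_ : col_mx _ _ = s^-1 *: col_mx x s%:M).
      by rewrite dotZr Lx mulr0 ltxx.
    by rewrite scale_col_mx scale_scalar_mx mulVf.
  have [x [s vE]] := colE v.
  have [s0|s0] := eqVneq s 0; last first.
    by apply: (finite_case x s); rewrite -?vE.
  (* A common negative vector at infinity is moved inside the hyperplane of [L],
     towards [y], to a finite one. *)
  have oneg : linearly_open [set w | forall i, qform (P i) w < 0].
    by apply: linearly_open_forall => i; exact: linearly_open_qform_lt0 (symP i).
  have [e e0 He] := oneg v (col_mx y 1%:M) neg.
  apply: (finite_case (x + e *: y) e); first by rewrite gt_eqF.
    rewrite LE dotDr dotZr; move: Lv; rewrite vE s0 LE; lra.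
  have -> : col_mx (x + e *: y) e%:M = v + e *: col_mx y 1%:M :> 'cV[R]_(n + 1).
    rewrite vE s0 scale_col_mx add_col_mx scale_scalar_mx mulr1.
    by rewrite [(0 : R)%:M]raddf0 add0r.
  by apply: He; rewrite gtr0_norm.
have [theta [_ PDtheta]] := hPD.
have n4 : (4 <= n + 1)%N by rewrite addn1.
have [a [a_ge0 a_neq0 psd]] := nonneg_multipliers symP n4 PDtheta noneg.
have symQ := combination_sym symP a.
have y_out : ~ agg_set A b c a y.
  rewrite /agg_set /neg_set /= -/(combination P a).
  by apply/negP; rewrite -leNgt; apply: psd; rewrite LE mulr1 subrr.
apply/y_out/Hy; split => //.
(* [S] lies in the half-space [0 < L], where the aggregated set is convex. *)
- move=> x Sx.
  suff [] : neg_set (combination P a) x /\ 0 < dot L (col_mx x 1%:M) by [].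
  move: x Sx; apply: conv_hull_sub.
    exact: convex_neg_set_halfspace.
  move=> x Sx; split; last exact: LSgt0.
  rewrite /neg_set /= qform_combination.
  have [i ai] := cV0Pn _ a_neq0.
  have ai_gt0 : 0 < a i 0 by rewrite lt_def ai a_ge0.
  rewrite dotE (bigD1 i) //= ltr_wnDr ?pmulr_rlt0 ?mxE //.
  + by apply: sumr_le0 => j _; rewrite mulr_ge0_le0 // mxE ltW //; exact: Sx.
  + exact: Sx.
(* The vectors [(x, 0)] in the hyperplane of [L] are those with [x] orthogonal
   to [l]. *)
- apply: (@num_neg_eigenvalues_le1 _ _ _ l).
    by rewrite linear_sum; apply: eq_bigr => i _; rewrite linearZ /= symA.
  move=> x lx; have := psd (col_mx x 0%:M).
  rewrite LE lx mulr0 subr0 => /(_ erefl).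
  rewrite /combination !qformE !(bform_sum (fun i => a i 0)).
  congr (0 <= _); apply: eq_bigr => i _; congr (_ * _).
  rewrite /bform /P /quad_mx tr_col_mx mul_row_block raddf0 trmx0 !mul0mx !addr0.
  by rewrite mul_row_col mulmx0 addr0.
Qed.
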